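(* Let $m\in\mathbb{R}\setminus\{-1,0,1\}$. Then Bour's surface of value $m$, i.e. the map $$\mathfrak{B}_m(r,\theta)=\begin{pmatrix}\dfrac{r^{m-1}}{m-1}\cos[(m-1)\theta]+\dfrac{r^{m+1}}{m+1}\cos[(m+1)\theta]\\[2mm]-\dfrac{r^{m-1}}{m-1}\sin[(m-1)\theta]+\dfrac{r^{m+1}}{m+1}\sin[(m+1)\theta]\\[2mm]2\,\dfrac{r^{m}}{m}\cos(m\theta)\end{pmatrix},$$ defined for $(r,\theta)\in\mathbb{R}^2$ with $r>0$ and $r\neq 1$, is a maximal surface in the Minkowski space $\mathbb{L}^3$ (with metric $dx^2+dy^2-dz^2$).
   Context: $\mathbb{L}^3$ denotes $\mathbb{R}^3$ with coordinates $(x,y,z)$ and the Lorentzian metric $\langle\cdot,\cdot\rangle=dx^2+dy^2-dz^2$. For a smooth parametrized surface $X(r,\theta)$, the coefficients of the first fundamental form are $E=\langle X_r,X_r\rangle$, $F=\langle X_r,X_\theta\rangle$, $G=\langle X_\theta,X_\theta\rangle$. The surface is spacelike if the induced metric (with coefficients $E,F,G$) is positive definite at every point. For a spacelike surface, let $e$ be a unit normal field (so $\langle e,X_r\rangle=\langle e,X_\theta\rangle=0$ and $\langle e,e\rangle=-1$) and put $L=\langle X_{rr},e\rangle$, $M=\langle X_{r\theta},e\rangle$, $N=\langle X_{\theta\theta},e\rangle$; the mean curvature is, up to a sign convention, $H=\dfrac{EN-2FM+GL}{2(EG-F^2)}$. A maximal surface in $\mathbb{L}^3$ is a spacelike surface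 whose mean curvature vanishes identically. Surfaces here are parametrized and are not required to be injective. *)

(* Defs.v *)
From Stdlib Require Export Reals.
From Coquelicot Require Export Coquelicot.
Open Scope R_scope.

(** Lorentz-Minkowski 3-space. *)

Definition L3 : Type := (R * R * R)%type.

Definition cx (v : L3) : R := fst (fst v).
Definition cy (v : L3) : R := snd (fst v).
Definition cz (v : L3) : R := snd v.

Definition lorentz (u v : L3) : R := cx u * cx v + cy u * cy v - cz u * cz v.

(** Maps [X r theta] into [L3] and their partial derivatives.  Coquelicot's
    [Derive] is total, so these are meaningful only together with [smooth_on]. *)

Definition d_r (X : R -> R -> L3) (r t : R) : L3 :=
  (Derive (fun s => cx (X s t)) r,
   Derive (fun s => cy (X s t)) r,
   Derive (fun s => cz (X s t)) r).

Definition d_theta (X : R -> R -> L3) (r t : R) : L3 :=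
  (Derive (fun s => cx (X r s)) t,
   Derive (fun s => cy (X r s)) t,
   Derive (fun s => cz (X r s)) t).

(** C^infinity on [D]; the intended use is with [D] open.  [ex_diff_n f n r t]
    asks for the iterated partial derivatives up to order [n] to exist and to
    be continuous at [(r, t)]. *)
Definition smooth_on (D : R * R -> Prop) (X : R -> R -> L3) : Prop :=
  forall r t, D (r, t) -> forall n,
    ex_diff_n (fun u v => cx (X u v)) n r t /\
    ex_diff_n (fun u v => cy (X u v)) n r t /\
    ex_diff_n (fun u v => cz (X u v)) n r t.

(** Regularity of the surface is not required separately: it follows from
    [spacelike]. *)
Definition parametrized_surface (D : R * R -> Prop) (X : R -> R -> L3) : Prop :=
  open D /\ smooth_on D X.

Definition coefE (X : R -> R -> L3) (r t : R) : R :=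
  lorentz (d_r X r t) (d_r X r t).
Definition coefF (X : R -> R -> L3) (r t : R) : R :=
  lorentz (d_r X r t) (d_theta X r t).
Definition coefG (X : R -> R -> L3) (r t : R) : R :=
  lorentz (d_theta X r t) (d_theta X r t).

Definition spacelike (D : R * R -> Prop) (X : R -> R -> L3) : Prop :=
  forall r t, D (r, t) ->
  forall a b : R, (a, b) <> (0, 0) ->
    0 < coefE X r t * a ^ 2 + 2 * coefF X r t * a * b + coefG X r t * b ^ 2.

Definition unit_normal_field (D : R * R -> Prop) (X e : R -> R -> L3) : Prop :=
  smooth_on D e /\
  forall r t, D (r, t) ->
    lorentz (e r t) (d_r X r t) = 0 /\
    lorentz (e r t) (d_theta X r t) = 0 /\
    lorentz (e r t) (e r t) = -1.

Definition coefL (X e : R -> R -> L3) (r t : R) : R :=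
  lorentz (d_r (d_r X) r t) (e r t).
Definition coefM (X e : R -> R -> L3) (r t : R) : R :=
  lorentz (d_theta (d_r X) r t) (e r t).
Definition coefN (X e : R -> R -> L3) (r t : R) : R :=
  lorentz (d_theta (d_theta X) r t) (e r t).

Definition mean_curvature (X e : R -> R -> L3) (r t : R) : R :=
  (coefE X r t * coefN X e r t - 2 * coefF X r t * coefM X e r t
     + coefG X r t * coefL X e r t)
  / (2 * (coefE X r t * coefG X r t - coefF X r t ^ 2)).

(** [e] is determined only up to sign, so the vanishing of the mean curvature
    is asked for every unit normal field; the existence clause keeps that from
    being vacuous. *)
Definition maximal_surface (D : R * R -> Prop) (X : R -> R -> L3) : Prop :=
  parametrized_surface D X /\
  spacelike D X /\
  (exists e, unit_normal_field D X e) /\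
  (forall e, unit_normal_field D X e ->
     forall r t, D (r, t) -> mean_curvature X e r t = 0).

(** Since [m] is real, the powers of [r > 0] are [Rpower]. *)
Definition bour (m r t : R) : L3 :=
  (Rpower r (m - 1) / (m - 1) * cos ((m - 1) * t)
     + Rpower r (m + 1) / (m + 1) * cos ((m + 1) * t),
   - (Rpower r (m - 1) / (m - 1)) * sin ((m - 1) * t)
     + Rpower r (m + 1) / (m + 1) * sin ((m + 1) * t),
   2 * (Rpower r m / m) * cos (m * t)).

Definition bour_domain (p : R * R) : Prop := 0 < fst p /\ fst p <> 1.

(* Main.v *)
(** In the coordinates [(r, t)] the map is isothermal up to scaling:
    [F = 0] and [G = r^2 E] with [E = (r^(m-2) (1 - r^2))^2], which is positive
    because [r <> 1].  Its components are harmonic in polar coordinates,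
    [X_tt + r^2 X_rr = - r X_r], so that [E N + G L = - r E <X_r, e> = 0] for
    every normal [e].  The Gauss map is
    [(2 r cos t, 2 r sin t, 1 + r^2) / (1 - r^2)]. *)

Require Import Defs.
From Stdlib Require Import Lra.

(** * Smoothness through a class of functions stable under partial derivatives *)

Lemma open_locally_2d (D : R * R -> Prop) (r t : R) :
  open D -> D (r, t) -> locally_2d (fun u v => D (u, v)) r t.
Proof.
  intros HD Hrt. apply locally_2d_locally.
  apply (filter_imp D); [intros [u v] H; exact H | exact (HD _ Hrt)].
Qed.

(** Induction on [n], for all members of [P] and all points of [D] at once. [ex_diff_n] speaks of
    the total [Derive], which agrees with [fr] or [ft] only on [D]; since [D] is open, this is
    agreement near the point, enough to transfer the induction hypothesis. *)
Lemma ex_diff_n_of_closed_class (D : R * R -> Prop) (P : (R -> R -> R) -> Prop) :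
  open D ->
  (forall f, P f -> exists fr ft, P fr /\ P ft /\
     forall r t, D (r, t) ->
       continuity_2d_pt f r t /\
       is_derive (fun s => f s t) r (fr r t) /\
       is_derive (fun s => f r s) t (ft r t)) ->
  forall f, P f -> forall r t, D (r, t) -> forall n, ex_diff_n f n r t.
Proof.
  intros HD Hstep f Hf r t Hrt n. revert f Hf r t Hrt.
  induction n as [|n IH]; intros f Hf r t Hrt;
    destruct (Hstep f Hf) as (fr & ft & Pr & Pt & Hd);
    destruct (Hd r t Hrt) as (Hc & Hr & Ht); simpl; split; auto.
  split; [eexists; exact Hr|]. split; [eexists; exact Ht|].
  split.
  - apply ex_diff_n_ext_loc with fr; [|now apply IH].
    apply locally_2d_impl with (2 := open_locally_2d D r t HD Hrt).
    apply locally_2d_forall; intros u v Huv.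
    symmetry; apply is_derive_unique; apply (Hd u v Huv).
  - apply ex_diff_n_ext_loc with ft; [|now apply IH].
    apply locally_2d_impl with (2 := open_locally_2d D r t HD Hrt).
    apply locally_2d_forall; intros u v Huv.
    symmetry; apply is_derive_unique; apply (Hd u v Huv).
Qed.

Lemma is_derive_Rpower (a x : R) :
  0 < x -> is_derive (fun s => Rpower s a) x (a * Rpower x (a - 1)).
Proof. intros Hx. apply is_derive_Reals. now apply derivable_pt_lim_power. Qed.

Lemma Derive_Rpower (a x : R) :
  0 < x -> Derive (fun s => Rpower s a) x = a * Rpower x (a - 1).
Proof. intros Hx. apply is_derive_unique. now apply is_derive_Rpower. Qed.

Lemma continuity_2d_pt_fst (f : R -> R) (r t : R) :
  ex_derive f r -> continuity_2d_pt (fun u _ => f u) r t.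
Proof.
  intros Hf.
  apply (continuity_1d_2d_pt_comp f (fun u _ => u)).
  - apply continuity_pt_filterlim. now apply (ex_derive_continuous f r).
  - apply continuity_2d_pt_id1.
Qed.

Lemma continuity_2d_pt_snd (f : R -> R) (r t : R) :
  ex_derive f t -> continuity_2d_pt (fun _ v => f v) r t.
Proof.
  intros Hf.
  apply (continuity_1d_2d_pt_comp f (fun _ v => v)).
  - apply continuity_pt_filterlim. now apply (ex_derive_continuous f t).
  - apply continuity_2d_pt_id2.
Qed.

(** An algebra of functions, stable under both partial derivatives, that
    contains the components of [bour m] and of its Gauss map. *)
Inductive bour_algebra : (R -> R -> R) -> Prop :=
| ba_const c : bour_algebra (fun _ _ => c)
| ba_radius : bour_algebra (fun r _ => r)
| ba_recip : bour_algebra (fun r _ => / (1 - r ^ 2))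
| ba_power a : bour_algebra (fun r _ => Rpower r a)
| ba_cos b : bour_algebra (fun _ t => cos (b * t))
| ba_sin b : bour_algebra (fun _ t => sin (b * t))
| ba_plus f g : bour_algebra f -> bour_algebra g ->
    bour_algebra (fun r t => f r t + g r t)
| ba_mult f g : bour_algebra f -> bour_algebra g ->
    bour_algebra (fun r t => f r t * g r t)
| ba_ext f g : (forall r t, f r t = g r t) -> bour_algebra f -> bour_algebra g.

Lemma one_minus_sqr_neq_0 (r : R) : 0 < r -> r <> 1 -> 1 - r ^ 2 <> 0.
Proof.
  intros H0 H1 H. apply H1.
  destruct (Rmult_integral (1 - r) (1 + r)); [rewrite <- H; ring | lra | lra].
Qed.

(** Every generator depends on one variable only, so one of its partials is zero and the other is
    again a sum or product of generators. Sums and products follow by linearity and the Leibniz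
    rule. The domain supplies [0 < r] for [Rpower] and [1 - r ^ 2 <> 0] for the reciprocal. *)
Lemma bour_algebra_partials (f : R -> R -> R) :
  bour_algebra f -> exists fr ft, bour_algebra fr /\ bour_algebra ft /\
    forall r t, bour_domain (r, t) ->
      continuity_2d_pt f r t /\
      is_derive (fun s => f s t) r (fr r t) /\
      is_derive (fun s => f r s) t (ft r t).
Proof.
  assert (Hradial : forall (g : R -> R) g', bour_algebra g' ->
    (forall r t, bour_domain (r, t) -> is_derive g r (g' r t)) ->
    exists fr ft, bour_algebra fr /\ bour_algebra ft /\
    forall r t, bour_domain (r, t) ->
      continuity_2d_pt (fun r _ => g r) r t /\
      is_derive (fun s => g s) r (fr r t) /\
      is_derive (fun s : R => g r) t (ft r t)).
  { intros g g' Hg' Hd. exists g', (fun _ _ => 0).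
    split; [easy|]. split; [constructor|]. intros r t Hrt.
    split; [apply continuity_2d_pt_fst; eexists; exact (Hd _ _ Hrt)|].
    split; [exact (Hd _ _ Hrt) | apply (is_derive_const (g r))]. }
  assert (Hangular : forall (g : R -> R) g', bour_algebra g' ->
    (forall r t, is_derive g t (g' r t)) ->
    exists fr ft, bour_algebra fr /\ bour_algebra ft /\
    forall r t, bour_domain (r, t) ->
      continuity_2d_pt (fun _ t => g t) r t /\
      is_derive (fun s : R => g t) r (fr r t) /\
      is_derive (fun s => g s) t (ft r t)).
  { intros g g' Hg' Hd. exists (fun _ _ => 0), g'.
    split; [constructor|]. split; [easy|]. intros r t _.
    split; [apply continuity_2d_pt_snd; eexists; exact (Hd r t)|].
    split; [apply (is_derive_const (g t)) | exact (Hd r t)]. }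
  induction 1 as [c| | |a|b|b|f g Hf IHf Hg IHg|f g Hf IHf Hg IHg|f g Hfg Hf IHf].
  - apply (Hradial (fun _ => c) (fun _ _ => 0)); [constructor|].
    intros r t _. apply (is_derive_const c).
  - apply (Hradial (fun r => r) (fun _ _ => 1)); [constructor|].
    intros r t _. apply (is_derive_id r).
  (* The derivative is written as a product of reciprocals, without a square, so that the
     constructors of [bour_algebra] match it. *)
  - apply (Hradial (fun r => / (1 - r ^ 2))
             (fun r _ => 2 * r * (/ (1 - r ^ 2) * / (1 - r ^ 2)))).
    + repeat constructor.
    + intros r t [H0 H1]. pose proof (one_minus_sqr_neq_0 r H0 H1).
      auto_derive; [simpl in *; lra|]. field. simpl in *; lra.
  - apply (Hradial (fun r => Rpower r a) (fun r _ => a * Rpower r (a - 1))).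
    + apply (ba_mult (fun _ _ => a) (fun r _ => Rpower r (a - 1))); constructor.
    + intros r t [H0 _]. now apply is_derive_Rpower.
  - apply (Hangular (fun t => cos (b * t)) (fun _ t => - b * sin (b * t))).
    + apply (ba_mult (fun _ _ => - b) (fun _ t => sin (b * t))); constructor.
    + intros r t. auto_derive; [easy | ring].
  - apply (Hangular (fun t => sin (b * t)) (fun _ t => b * cos (b * t))).
    + apply (ba_mult (fun _ _ => b) (fun _ t => cos (b * t))); constructor.
    + intros r t. auto_derive; [easy | ring].
  - destruct IHf as (fr & ft & Pfr & Pft & Hdf), IHg as (gr & gt & Pgr & Pgt & Hdg).
    exists (fun r t => fr r t + gr r t), (fun r t => ft r t + gt r t).
    split; [now constructor|]. split; [now constructor|]. intros r t Hrt.
    destruct (Hdf r t Hrt) as (? & ? & ?), (Hdg r t Hrt) as (? & ? & ?).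
    split; [now apply continuity_2d_pt_plus|].
    split; now apply (is_derive_plus (V := R_NormedModule)).
  - destruct IHf as (fr & ft & Pfr & Pft & Hdf), IHg as (gr & gt & Pgr & Pgt & Hdg).
    exists (fun r t => fr r t * g r t + f r t * gr r t),
      (fun r t => ft r t * g r t + f r t * gt r t).
    split; [now apply ba_plus; apply ba_mult|].
    split; [now apply ba_plus; apply ba_mult|]. intros r t Hrt.
    destruct (Hdf r t Hrt) as (? & ? & ?), (Hdg r t Hrt) as (? & ? & ?).
    split; [now apply continuity_2d_pt_mult|].
    split.
    + apply (is_derive_mult (fun s => f s t) (fun s => g s t)); auto using Rmult_comm.
    + apply (is_derive_mult (f r) (g r)); auto using Rmult_comm.
  - destruct IHf as (fr & ft & Pfr & Pft & Hdf). exists fr, ft.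
    split; [easy|]. split; [easy|]. intros r t Hrt.
    destruct (Hdf r t Hrt) as (? & ? & ?).
    split; [now apply continuity_2d_pt_ext with f|].
    split; [apply (is_derive_ext (fun s => f s t)) | apply (is_derive_ext (f r))]; auto.
Qed.

Lemma open_bour_domain : open bour_domain.
Proof.
  apply open_and.
  - apply (open_comp (fst : R * R -> R) (fun x => 0 < x)); [|apply open_gt].
    intros x _. apply continuous_fst.
  - apply (open_comp (fst : R * R -> R) (fun x => x <> 1)); [|apply open_neq].
    intros x _. apply continuous_fst.
Qed.

Lemma smooth_on_of_bour_algebra (X : R -> R -> L3) :
  bour_algebra (fun r t => cx (X r t)) ->
  bour_algebra (fun r t => cy (X r t)) ->
  bour_algebra (fun r t => cz (X r t)) ->
  smooth_on bour_domain X.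
Proof.
  intros Hx Hy Hz r t Hrt n.
  repeat split;
    apply (ex_diff_n_of_closed_class bour_domain bour_algebra);
    auto using open_bour_domain, bour_algebra_partials.
Qed.

Lemma smooth_bour (m : R) : smooth_on bour_domain (bour m).
Proof.
  assert (Hc : forall c a b, bour_algebra (fun r t => c * Rpower r a * cos (b * t))).
  { intros c a b.
    apply (ba_mult (fun r _ => c * Rpower r a) (fun _ t => cos (b * t))); [|constructor].
    apply (ba_mult (fun _ _ => c) (fun r _ => Rpower r a)); constructor. }
  assert (Hs : forall c a b, bour_algebra (fun r t => c * Rpower r a * sin (b * t))).
  { intros c a b.
    apply (ba_mult (fun r _ => c * Rpower r a) (fun _ t => sin (b * t))); [|constructor].
    apply (ba_mult (fun _ _ => c) (fun r _ => Rpower r a)); constructor. }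
  apply smooth_on_of_bour_algebra.
  (* Each component is a combination of terms [r^k cos (k t)] or [r^k sin (k t)]; [ba_ext] absorbs
     the difference between this shape and the quotients in [bour]. *)
  - refine (ba_ext _ _ _ (ba_plus _ _ (Hc (/ (m - 1)) (m - 1) (m - 1))
                                       (Hc (/ (m + 1)) (m + 1) (m + 1)))).
    intros r t; unfold bour, cx, Rdiv; simpl; ring.
  - refine (ba_ext _ _ _ (ba_plus _ _ (Hs (- / (m - 1)) (m - 1) (m - 1))
                                       (Hs (/ (m + 1)) (m + 1) (m + 1)))).
    intros r t; unfold bour, cy, Rdiv; simpl; ring.
  - refine (ba_ext _ _ _ (Hc (2 * / m) m m)).
    intros r t; unfold bour, cz, Rdiv; simpl; ring.
Qed.

(** Inverse stereographic projection, from [(0, 0, -1)], of the point with polar coordinates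
    [(r, t)] onto the two-sheeted hyperboloid of unit timelike vectors: upper sheet for [r < 1],
    lower sheet for [r > 1]. It is the same for all [m]. *)
Definition bour_normal (r t : R) : L3 :=
  (2 * r * cos t / (1 - r ^ 2), 2 * r * sin t / (1 - r ^ 2), (1 + r ^ 2) / (1 - r ^ 2)).

Lemma smooth_bour_normal : smooth_on bour_domain bour_normal.
Proof.
  apply smooth_on_of_bour_algebra.
  (* The factor [1 * t] puts the cosine in the form required by [ba_cos]. *)
  - apply (ba_ext (fun r t => 2 * r * cos (1 * t) * / (1 - r ^ 2))).
    + intros r t. unfold bour_normal, cx; simpl. now rewrite Rmult_1_l.
    + apply (ba_mult (fun r t => 2 * r * cos (1 * t)) (fun r _ => / (1 - r ^ 2)));
        [|constructor].
      apply (ba_mult (fun r _ => 2 * r) (fun _ t => cos (1 * t))); repeat constructor.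
  - apply (ba_ext (fun r t => 2 * r * sin (1 * t) * / (1 - r ^ 2))).
    + intros r t. unfold bour_normal, cy; simpl. now rewrite Rmult_1_l.
    + apply (ba_mult (fun r t => 2 * r * sin (1 * t)) (fun r _ => / (1 - r ^ 2)));
        [|constructor].
      apply (ba_mult (fun r _ => 2 * r) (fun _ t => sin (1 * t))); repeat constructor.
  - apply (ba_ext (fun r t => (1 + r * r) * / (1 - r ^ 2))).
    + intros r t. unfold bour_normal, cz, Rdiv; simpl. ring.
    + repeat constructor.
Qed.

(** * First and second partial derivatives of the surface *)

Section Derivatives.

Variables (m : R) (hm_neg1 : m <> -1) (hm_0 : m <> 0) (hm_1 : m <> 1).

Lemma d_r_bour (r t : R) : 0 < r ->
  d_r (bour m) r t =
  (Rpower r (m - 1 - 1) * cos ((m - 1) * t) + Rpower r (m + 1 - 1) * cos ((m + 1) * t),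
   - Rpower r (m - 1 - 1) * sin ((m - 1) * t) + Rpower r (m + 1 - 1) * sin ((m + 1) * t),
   2 * Rpower r (m - 1) * cos (m * t)).
Proof.
  intros Hr.
  unfold d_r, bour, cx, cy, cz; simpl.
  f_equal; [f_equal|]; apply is_derive_unique;
    (* [auto_derive] keeps [Rpower] opaque: it leaves differentiability goals and [Derive] terms,
       settled by the power rule. Exponents such as [m - 1 - 1] are kept in the form that this rule
       produces. *)
    auto_derive; repeat split; try (eexists; now apply is_derive_Rpower);
    rewrite ?Derive_Rpower by exact Hr; field; lra.
Qed.

Lemma d_theta_bour (r t : R) :
  d_theta (bour m) r t =
  (- Rpower r (m - 1) * sin ((m - 1) * t) - Rpower r (m + 1) * sin ((m + 1) * t),
   - Rpower r (m - 1) * cos ((m - 1) * t) + Rpower r (m + 1) * cos ((m + 1) * t),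
   - 2 * Rpower r m * sin (m * t)).
Proof.
  unfold d_theta, bour, cx, cy, cz; simpl.
  f_equal; [f_equal|]; apply is_derive_unique; auto_derive; auto; field; lra.
Qed.

Lemma d_theta_d_theta_bour (r t : R) :
  d_theta (d_theta (bour m)) r t =
  (- (m - 1) * Rpower r (m - 1) * cos ((m - 1) * t)
     - (m + 1) * Rpower r (m + 1) * cos ((m + 1) * t),
   (m - 1) * Rpower r (m - 1) * sin ((m - 1) * t)
     - (m + 1) * Rpower r (m + 1) * sin ((m + 1) * t),
   - 2 * m * Rpower r m * cos (m * t)).
Proof.
  unfold d_theta at 1.
  f_equal; [f_equal|];
    (erewrite Derive_ext; [|intros s; rewrite d_theta_bour; reflexivity]);
    unfold cx, cy, cz; simpl;
    apply is_derive_unique; auto_derive; auto; ring.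
Qed.

Lemma d_r_d_r_bour (r t : R) : 0 < r ->
  d_r (d_r (bour m)) r t =
  ((m - 1 - 1) * Rpower r (m - 1 - 1 - 1) * cos ((m - 1) * t)
     + (m + 1 - 1) * Rpower r (m + 1 - 1 - 1) * cos ((m + 1) * t),
   - (m - 1 - 1) * Rpower r (m - 1 - 1 - 1) * sin ((m - 1) * t)
     + (m + 1 - 1) * Rpower r (m + 1 - 1 - 1) * sin ((m + 1) * t),
   2 * (m - 1) * Rpower r (m - 1 - 1) * cos (m * t)).
Proof.
  intros Hr.
  (* The formula for [d_r] is available only at positive radii, so it is substituted under the outer
     derivative on a neighbourhood of [r]. *)
  assert (Hloc : locally r (fun s => 0 < s)) by exact (open_gt 0 r Hr).
  unfold d_r at 1.
  f_equal; [f_equal|];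
    (erewrite Derive_ext_loc;
      [|apply (filter_imp (fun s => 0 < s)); [|exact Hloc];
        intros s Hs; rewrite (d_r_bour s t Hs); reflexivity]);
    unfold cx, cy, cz; simpl; apply is_derive_unique;
    auto_derive; repeat split; try (eexists; now apply is_derive_Rpower);
    rewrite ?Derive_Rpower by exact Hr; ring.
Qed.

End Derivatives.

(** * Reduction to [r], [Rpower r m] and the angles [t] and [m * t] *)

Lemma Rpower_minus_1 (r a : R) : 0 < r -> Rpower r (a - 1) = Rpower r a / r.
Proof.
  intros Hr. unfold Rminus, Rdiv.
  now rewrite Rpower_plus, Rpower_Ropp, (Rpower_1 r Hr).
Qed.

Lemma Rpower_plus_1 (r a : R) : 0 < r -> Rpower r (a + 1) = Rpower r a * r.
Proof. intros Hr. now rewrite Rpower_plus, (Rpower_1 r Hr). Qed.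

Lemma cos_m_minus_1 (m t : R) :
  cos ((m - 1) * t) = cos (m * t) * cos t + sin (m * t) * sin t.
Proof. rewrite <- cos_minus. f_equal. ring. Qed.

Lemma sin_m_minus_1 (m t : R) :
  sin ((m - 1) * t) = sin (m * t) * cos t - cos (m * t) * sin t.
Proof. rewrite <- sin_minus. f_equal. ring. Qed.

Lemma cos_m_plus_1 (m t : R) :
  cos ((m + 1) * t) = cos (m * t) * cos t - sin (m * t) * sin t.
Proof. rewrite <- cos_plus. f_equal. ring. Qed.

Lemma sin_m_plus_1 (m t : R) :
  sin ((m + 1) * t) = sin (m * t) * cos t + cos (m * t) * sin t.
Proof. rewrite <- sin_plus. f_equal. ring. Qed.

(** Oriented with a monomial on the left, to serve as a rewriting rule for [ring [...]]. *)
Lemma sin_mul_sin (x : R) : sin x * sin x = 1 - cos x * cos x.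
Proof. pose proof (sin2_cos2 x) as H. unfold Rsqr in H. lra. Qed.

(** Afterwards all terms are rational in [r] and polynomial in [Rpower r m] and the sines and
    cosines of [t] and [m * t]; metric identities become [field] identities modulo the two
    Pythagorean relations. *)
Ltac expand_bour :=
  repeat (rewrite Rpower_minus_1 by assumption);
  repeat (rewrite Rpower_plus_1 by assumption);
  rewrite ?cos_m_minus_1, ?sin_m_minus_1, ?cos_m_plus_1, ?sin_m_plus_1.

(** * The fundamental forms, the unit normal and harmonicity *)

Section FundamentalForms.

Variables (m : R) (hm_neg1 : m <> -1) (hm_0 : m <> 0) (hm_1 : m <> 1).

(** Read as a complex number, the horizontal part of [X_r] is
    [r^(m-2) e^(-i(m-1)t) + r^m e^(i(m+1)t)], of squared modulus
    [r^(2m-4) + r^(2m) + 2 r^(2m-2) cos(2mt)]. Subtracting [4 r^(2m-2) cos^2(mt)] leaves a perfect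
    square. *)
Lemma coefE_bour (r t : R) : 0 < r ->
  coefE (bour m) r t = (Rpower r m / r ^ 2 * (1 - r ^ 2)) ^ 2.
Proof using hm_neg1 hm_0 hm_1.
  intros Hr. unfold coefE. rewrite d_r_bour by assumption.
  unfold lorentz, cx, cy, cz; simpl fst; simpl snd. expand_bour.
  field_simplify_eq; [|lra]. ring [(sin_mul_sin t) (sin_mul_sin (m * t))].
Qed.

Lemma coefF_bour (r t : R) : 0 < r -> coefF (bour m) r t = 0.
Proof using hm_neg1 hm_0 hm_1.
  intros Hr. unfold coefF. rewrite d_r_bour, d_theta_bour by assumption.
  unfold lorentz, cx, cy, cz; simpl fst; simpl snd. expand_bour.
  field_simplify_eq; [|lra]. ring [(sin_mul_sin t) (sin_mul_sin (m * t))].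
Qed.

Lemma coefG_bour (r t : R) : 0 < r ->
  coefG (bour m) r t = r ^ 2 * coefE (bour m) r t.
Proof using hm_neg1 hm_0 hm_1.
  intros Hr. rewrite coefE_bour by assumption.
  unfold coefG. rewrite d_theta_bour by assumption.
  unfold lorentz, cx, cy, cz; simpl fst; simpl snd. expand_bour.
  field_simplify_eq; [|lra]. ring [(sin_mul_sin t) (sin_mul_sin (m * t))].
Qed.

Lemma coefE_bour_pos (r t : R) : bour_domain (r, t) -> 0 < coefE (bour m) r t.
Proof using hm_neg1 hm_0 hm_1.
  intros [Hr Hr1]; simpl in Hr, Hr1. rewrite coefE_bour by assumption.
  apply pow2_gt_0. apply Rmult_integral_contrapositive_currified.
  - apply Rgt_not_eq, Rdiv_lt_0_compat; [apply exp_pos | now apply pow_lt].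
  - now apply one_minus_sqr_neq_0.
Qed.

Lemma spacelike_bour : spacelike bour_domain (bour m).
Proof using hm_neg1 hm_0 hm_1.
  intros r t Hrt a b Hab. pose proof (coefE_bour_pos r t Hrt) as HE.
  destruct Hrt as [Hr _]; simpl in Hr.
  rewrite coefF_bour, coefG_bour by assumption.
  (* With [F = 0] and [G = r^2 E] the metric is [E] times the flat metric in polar coordinates. *)
  replace (_ + _) with (coefE (bour m) r t * (a ^ 2 + (r * b) ^ 2)) by ring.
  apply Rmult_lt_0_compat; [exact HE|].
  pose proof (pow2_ge_0 a); pose proof (pow2_ge_0 (r * b)).
  destruct (Req_dec a 0) as [->|Ha].
  - assert (Hb : b <> 0) by (intros ->; now apply Hab).
    assert (0 < (r * b) ^ 2); [|lra].
    apply pow2_gt_0, Rmult_integral_contrapositive_currified; lra.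
  - pose proof (pow2_gt_0 a Ha). lra.
Qed.

Lemma unit_normal_field_bour_normal : unit_normal_field bour_domain (bour m) bour_normal.
Proof using hm_neg1 hm_0 hm_1.
  split; [apply smooth_bour_normal|]. intros r t [Hr Hr1]; simpl in Hr, Hr1.
  pose proof (one_minus_sqr_neq_0 r Hr Hr1) as Hd.
  rewrite d_r_bour, d_theta_bour by assumption.
  unfold lorentz, bour_normal, cx, cy, cz; simpl fst; simpl snd. expand_bour.
  repeat split; (field_simplify_eq; [|lra]);
    ring [(sin_mul_sin t) (sin_mul_sin (m * t))].
Qed.

(** For a term [r^k cos (k t)] or [r^k sin (k t)], the operators [r^2 d_rr], [r d_r] and [d_tt]
    multiply by [k(k-1)], [k] and [-k^2], which sum to zero. Pairing the resulting vector identity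
    with [e] gives the claim. *)
Lemma bour_harmonic (e : R -> R -> L3) (r t : R) : 0 < r ->
  coefN (bour m) e r t + r ^ 2 * coefL (bour m) e r t
  = - r * lorentz (e r t) (d_r (bour m) r t).
Proof using hm_neg1 hm_0 hm_1.
  intros Hr. unfold coefN, coefL.
  rewrite d_theta_d_theta_bour, d_r_d_r_bour, d_r_bour by assumption.
  unfold lorentz, cx, cy, cz; simpl fst; simpl snd.
  (* The identity is linear in the trigonometric factors, so these stay atoms and only the powers
     are expanded. *)
  repeat (rewrite Rpower_minus_1 by assumption).
  repeat (rewrite Rpower_plus_1 by assumption).
  field; lra.
Qed.

End FundamentalForms.

Theorem theorem2 (m : R) (hm_neg1 : m <> -1) (hm_0 : m <> 0) (hm_1 : m <> 1) :
  maximal_surface bour_domain (bour m).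
Proof.
  split; [split; [apply open_bour_domain | apply smooth_bour]|].
  split; [now apply spacelike_bour|].
  split; [exists bour_normal; now apply unit_normal_field_bour_normal|].
  intros e [_ He] r t Hrt.
  destruct (He r t Hrt) as [Hn _]. destruct Hrt as [Hr _]; simpl in Hr.
  unfold mean_curvature. rewrite coefF_bour, coefG_bour by assumption.
  (* The numerator factors through [N + r^2 L], which harmonicity turns into a multiple of the
     pairing of [e] with the tangent vector [X_r], hence zero. *)
  replace (_ - _ + _) with
    (coefE (bour m) r t * (coefN (bour m) e r t + r ^ 2 * coefL (bour m) e r t)) by ring.
  rewrite bour_harmonic, Hn by assumption. unfold Rdiv. ring.
Qed.
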